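(* Let $(v_n)_{n=1}^\infty$ be a sequence in the unit circle $S^1\subset\mathbb{R}^2$ such that $D=\{v_n:n\in\mathbb{N}\}$ is dense in $S^1$ and such that for each $v\in D$ and each $N\ge 1$ there exists $n\ge N$ with $v_{n+1}=v_{n+2}=\dots=v_{n+N}=v$. Let $P\subset\mathbb{R}^2$ be the set constructed from $(v_n)$ by the construction described in the context. Then $P$ is not $\sigma$-directionally lower porous, i.e. $P$ is not a countable union of directionally lower porous subsets of $\mathbb{R}^2$.
   Context: $\mathbb{R}^2$ carries the Euclidean norm $\|\cdot\|$; $B(x,r)$ is the open ball of centre $x$ and radius $r$. For non-empty $A\subset\mathbb{R}^2$ put $d(x,A)=\inf\{\|x-y\|:y\in A\}$ and, for $r>0$, $B(A,r)=\{x\in\mathbb{R}^2:d(x,A)<r\}$; also $B(\varnothing,r)=\varnothing$. For $v=(v_1,v_2)\in\mathbb{R}^2$ let $v^\bot=(-v_2,v_1)$. Construction of $P$ from the sequence $(v_n)$: for $n\in\mathbb{N}$, $k\in\mathbb{Z}$ let $L_n^k=\{(k/2^{6n})v_n^\bot+tv_n:t\in\mathbb{R}\}$. Put $H_0=\varnothing$ and, for $n\ge1$, $$C_n=\Big(\bigcup_{k=-\infty}^{\infty}L_n^k\Big)\setminus B(H_{n-1},1/2^{6n}),\qquad H_n=H_{n-1}\cup\bigcup_{x\in C_n}B(x,1/2^{6(n+1)}).$$ Let $H=\bigcup_{n=1}^\infty H_n$ and $P=\mathbb{R}^2\setminus H$. Directional lower porosity: a subset $Q$ of a Banach space $X$ is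 lower porous at $x\in Q$ in direction $v\in X$ if there exist $\rho>0$ and $r_0>0$ such that for every $0<r<r_0$ there exists a point $y$ on the line through $x$ in direction $v$ with $\|x-y\|<r$ and $B(y,\rho r)\cap Q=\varnothing$. $Q$ is directionally lower porous if at each of its points $x$ it is lower porous in some direction (which may depend on $x$). A set is $\sigma$-directionally lower porous if it is a countable union of directionally lower porous sets. *)

(* Defs.v *)
From mathcomp Require Import all_boot all_order all_algebra.
From mathcomp Require Import all_classical all_reals all_analysis.
Set Implicit Arguments.
Unset Strict Implicit.
Unset Printing Implicit Defensive.
Import Order.TTheory GRing.Theory Num.Theory.
Import numFieldNormedType.Exports.
Local Open Scope classical_set_scope.
Local Open Scope ring_scope.

Section Plane.
Context {R : realType}.
Implicit Types (x y u : R * R) (r rho t : R) (A Q : set (R * R)).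

(* The library norm `|x| and [ball] on R * R are those of the sup norm, so the
   Euclidean versions are defined separately; the topologies coincide. *)
Definition enorm x : R := Num.sqrt (x.1 ^+ 2 + x.2 ^+ 2).

Definition eball x r : set (R * R) := [set y | enorm (x - y) < r].

Definition S1 : set (R * R) := [set u | enorm u = 1].

Definition perp u : R * R := (- u.2, u.1).

Definition edist x A : R := inf [set enorm (x - y) | y in A].

(* [inf set0 = 0] in the library, hence the explicit non-emptiness. *)
Definition enbhd A r : set (R * R) := [set x | A !=set0 /\ edist x A < r].

Definition line x u : set (R * R) := [set x + t *: u | t in [set: R]].

Definition lower_porous_at Q x u : Prop :=
  exists rho r0 : R, [/\ 0 < rho, 0 < r0 &
    forall r, 0 < r -> r < r0 ->
      exists y, [/\ line x u y, enorm (x - y) < r &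
                    eball y (rho * r) `&` Q = set0]].

Definition directionally_lower_porous Q : Prop :=
  forall x, Q x -> exists u, lower_porous_at Q x u.

Definition sigma_directionally_lower_porous A : Prop :=
  exists Q : nat -> set (R * R),
    (forall i, directionally_lower_porous (Q i)) /\ A = \bigcup_i Q i.

(* Sequences (v_n) are indexed from n = 1; the value [v 0] is never used. *)
Implicit Types v : nat -> R * R.

Definition Lline v (n : nat) (k : int) : set (R * R) :=
  line ((k%:~R / 2 ^+ (6 * n)) *: perp (v n)) (v n).

(* C_n, as a function of B = H_{n-1}. *)
Definition Cset v (n : nat) (B : set (R * R)) : set (R * R) :=
  (\bigcup_(k in [set: int]) Lline v n k) `\` enbhd B (1 / 2 ^+ (6 * n)).

Fixpoint Hset v (n : nat) : set (R * R) :=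
  match n with
  | 0%N => set0
  | m.+1 => Hset v m `|`
      \bigcup_(x in Cset v m.+1 (Hset v m)) eball x (1 / 2 ^+ (6 * (m.+1 + 1)))
  end.

Definition Hunion v : set (R * R) := \bigcup_(n in [set n | (1 <= n)%N]) Hset v n.

Definition Pset v : set (R * R) := ~` Hunion v.

Definition Dset v : set (R * R) := [set v n | n in [set n | (1 <= n)%N]].

End Plane.

(* Main.v *)
(* Call a cell of level m a ball of radius comparable to 2^-(6(m+1)) that avoids
   H_m.  A cell contains a cell of the next level, obtained by moving away from
   the nearest line of level m+1; along a run of stages with constant direction
   w, one perpendicular shift frees a whole segment of direction w, whose points
   are then all centres of tiny cells.  Suppose that a set A, porous in direction
   w with fixed constants inside a set Q containing A, met every subcell of some
   cell.  A point a of A near the middle of such a segment has a hole of Q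
   centred near the segment, yet the cell around the centre of the hole contains
   a point of A.  Hence every cell has a subcell missing A, and, since countably
   many sets A exhaust the porous pieces, a nested sequence of cells shrinks to a
   point of P outside all of them. *)
Require Import Defs.
From mathcomp Require Import all_boot all_order all_algebra.
From mathcomp Require Import all_classical all_reals all_analysis.
From mathcomp Require Import ring lra.
Import Order.TTheory GRing.Theory Num.Theory.
Import numFieldNormedType.Exports.
Local Open Scope classical_set_scope.
Local Open Scope ring_scope.

Section Porosity.
Context {R : realType}.
Implicit Types (x y z w : R * R) (v : nat -> R * R) (r rho s t u : R).
Implicit Types (k l m n q : nat).

(** * Sup and Euclidean norms, and the coordinate across a direction *)

Lemma prod_normP x r : reflect (`|x.1| <= r /\ `|x.2| <= r) (`|x| <= r).
Proof. by rewrite prod_normE ge_max; exact: andP. Qed.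

Lemma prod_norm_fst x : `|x.1| <= `|x|.
Proof. by have /prod_normP[] := lexx `|x|. Qed.

Lemma prod_norm_snd x : `|x.2| <= `|x|.
Proof. by have /prod_normP[] := lexx `|x|. Qed.

Lemma enorm_ge0 x : 0 <= enorm x.
Proof. exact: sqrtr_ge0. Qed.

Lemma enorm_sqr x : enorm x ^+ 2 = x.1 ^+ 2 + x.2 ^+ 2.
Proof. by rewrite sqr_sqrtr // addr_ge0 // sqr_ge0. Qed.

Lemma norm_le_enorm x : `|x| <= enorm x.
Proof.
apply/prod_normP; split; rewrite -(ler_pXn2r (n := 2)) ?nnegrE ?enorm_ge0 //;
  by rewrite enorm_sqr real_normK ?num_real // ?lerDl ?lerDr sqr_ge0.
Qed.

Lemma enorm_le_norm x : enorm x <= 2 * `|x|.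
Proof.
rewrite -(ler_pXn2r (n := 2)) ?nnegrE ?enorm_ge0 ?mulr_ge0 // enorm_sqr.
rewrite -(real_normK (num_real x.1)) -(real_normK (num_real x.2)).
have h1 := prod_norm_fst x; have h2 := prod_norm_snd x.
have a1 := normr_ge0 x.1; have a2 := normr_ge0 x.2; nra.
Qed.

Lemma enormZ t x : enorm (t *: x) = `|t| * enorm x.
Proof.
by rewrite /enorm /= !exprMn -mulrDr sqrtrM ?sqr_ge0 // sqrtr_sqr.
Qed.

Lemma S1_sqr w : S1 w -> w.1 ^+ 2 + w.2 ^+ 2 = 1.
Proof. by rewrite /S1 /= -enorm_sqr => ->; rewrite expr1n. Qed.

Lemma norm_S1_le1 {w} : S1 w -> `|w| <= 1.
Proof. by move=> <-; exact: norm_le_enorm. Qed.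

Lemma norm_perp w : `|perp w| = `|w|.
Proof. by rewrite !prod_normE /= normrN maxC. Qed.

Lemma norm_scale_le t {w} : `|w| <= 1 -> `|t *: w| <= `|t|.
Proof. by move=> w1; rewrite prod_norm_scale ler_piMr. Qed.

(** The inner product with [perp w]: for a unit [w], the signed distance to the line through 0 of
    direction [w]. *)
Definition height w x : R := x.2 * w.1 - x.1 * w.2.

Lemma heightB w x y : height w (x - y) = height w x - height w y.
Proof. by rewrite /height /=; ring. Qed.

Lemma height_shift w x s t :
  S1 w -> height w (x + s *: perp w + t *: w) = height w x + s.
Proof.
move=> /S1_sqr w1; rewrite /height /= /GRing.scale /=.
by rewrite -[X in _ = _ + X]mulr1 -w1; ring.
Qed.

Lemma height_le_enorm w x : S1 w -> `|height w x| <= enorm x.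
Proof.
move=> /S1_sqr w1; rewrite -(ler_pXn2r (n := 2)) ?nnegrE ?enorm_ge0 //.
rewrite enorm_sqr real_normK ?num_real // -[leRHS]mulr1 -w1 /height.
rewrite -subr_ge0 (_ : _ - _ = (x.1 * w.1 + x.2 * w.2) ^+ 2) ?sqr_ge0 //; ring.
Qed.

(** The spacing of the lines of stage n; the balls added at stage n have radius [mesh n.+1]. *)
Definition mesh n : R := 1 / 2 ^+ (6 * n).

Lemma mesh_gt0 n : 0 < mesh n.
Proof. by rewrite divr_gt0 // exprn_gt0. Qed.

Lemma mesh_step n : mesh n = 64 * mesh n.+1.
Proof.
rewrite /mesh mulnS exprD.
have : (2 : R) ^+ (6 * n) != 0 by rewrite expf_neq0.
by move: (2 ^+ _) => e e0; field.
Qed.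

Lemma mesh_add n k : mesh (n + k) <= mesh n.
Proof.
elim: k => [|k IH]; first by rewrite addn0.
rewrite addnS; apply: le_trans IH; rewrite [leRHS]mesh_step.
by have := mesh_gt0 (n + k).+1; lra.
Qed.

(** Lets q further stages absorb a porosity constant 1/(q+1). *)
Lemma mesh_mul_add q n k : (q <= k)%N -> q.+1%:R * mesh (n + k) <= mesh n.
Proof.
move=> /subnKC <-; rewrite addnA.
apply: (le_trans (ler_wpM2l (ler0n _ _) (mesh_add (n + q) (k - q)))).
elim: q => [|q IH]; first by rewrite addn0 mul1r.
apply: le_trans IH; rewrite [in leRHS]mesh_step addnS -[q.+2%:R]natr1.
have := mesh_gt0 (n + q).+1; have := ler1n R q.+1; rewrite ltn0Sn; nra.
Qed.

Lemma Lline_height v n (k : int) x :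
  S1 (v n) -> Lline v n k x -> height (v n) x = k%:~R * mesh n.
Proof.
move=> vS [t _ <-].
rewrite -[_ *: perp _]add0r height_shift // /height /=.
by rewrite !mul0r subrr add0r /mesh mul1r.
Qed.

(** * Leaving the lines of a single stage *)

Lemma away_from_multiples u d e : 0 <= e -> 4 * e <= d -> 0 < d ->
  exists s, `|s| <= e /\ forall k : int, e <= `|u + s - k%:~R * d|.
Proof.
move=> e0 ed d0.
pose f := Num.floor (u / d).
have fd : f%:~R * d <= u by rewrite -ler_pdivlMr // Num.Theory.floor_le_tmp.
have df : u < f%:~R * d + d.
  rewrite -[X in _ + X]mul1r -mulrDl -ltr_pdivrMr //.
  by rewrite -(intrD _ f 1) floorD1_gt.
have split_at (k : int) : k%:~R * d <= f%:~R * d \/ f%:~R * d + d <= k%:~R * d.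
  have [kf|fk] := lerP k f; [left|right].
    by rewrite ler_pM2r // ler_int.
  by rewrite -[X in _ + X]mul1r -mulrDl ler_pM2r // -(intrD _ f 1) ler_int lezD1.
(* Moving by e towards the middle of the interval leaves at least d/2 - e >= e to the far
   endpoint. *)
have [lo|hi] := lerP (u - f%:~R * d) (d / 2).
- exists e; split=> [|k]; first by rewrite ger0_norm.
  by rewrite ler_normr; apply/orP; case: (split_at k) => ?; [left|right]; lra.
- exists (- e); split=> [|k]; first by rewrite normrN ger0_norm.
  by rewrite ler_normr; apply/orP; case: (split_at k) => ?; [left|right]; lra.
Qed.

(** A cell of level m is given by [clear v (mesh m.+1 / 2) m z]. The ball is a sup-norm one;
    comparing with Euclidean balls costs a factor 2, which the margins absorb. *)
Definition clear v rho m z := forall y, `|z - y| < rho -> ~ Hset v m y.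

Lemma clear_shift v rho m z rho' z' :
  `|z - z'| + rho' <= rho -> clear v rho m z -> clear v rho' m z'.
Proof.
move=> le_rho cz y yz'; apply: cz; apply: lt_le_trans le_rho.
by rewrite -(subrKA z' z (- y)) (le_lt_trans (ler_normD _ _)) // ltrD2l.
Qed.

(* The shift depends on z only through its height, so that it serves all the
   points of a segment of direction [v m.+1]. *)
Lemma clear_step v m u : S1 (v m.+1) ->
  exists s, `|s| <= mesh m.+1 / 32 /\
    forall z, height (v m.+1) z = u -> clear v (mesh m.+1 / 16) m z ->
      clear v (mesh m.+2 / 2) m.+1 (z + s *: perp (v m.+1)).
Proof.
set w := v m.+1 => wS; have d0 := mesh_gt0 m.+1.
have dS := mesh_step m.+1.
(* [mesh m.+1 / 32] is [2 * mesh m.+2]: one [mesh m.+2] for the Euclidean size of the new ball, one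
   for the radius of the balls of stage m+1. *)
have [||//|s [s_le s_away]] := @away_from_multiples u (mesh m.+1) (mesh m.+1 / 32).
- by lra.
- by lra.
have pw1 : `|perp w| <= 1 by rewrite norm_perp norm_S1_le1.
exists s; split=> // z zu cz y yz; move=> [|[c [[k _ ck] _]]].
  apply: (@clear_shift _ _ _ _ (mesh m.+2 / 2) (z + s *: perp w) _ cz) => //.
  rewrite opprD addNKr normrN.
  by have := norm_scale_le s pw1; lra.
rewrite /eball /= addn1 -/(mesh m.+2) => cy.
have := s_away k; rewrite -zu -[z in height w z]addr0.
have hz : height w (z + s *: perp w) = height w z + s.
  by rewrite -[z + _]addr0 -(scale0r w) height_shift.
rewrite addr0 -hz -(Lline_height _ _ _ _ wS ck) -heightB leNgt => /negP; apply.
set z' := z + _ in yz *.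
have -> : height w (z' - c) = height w (z' - y) - height w (c - y).
  by rewrite !heightB; ring.
apply: le_lt_trans (ler_normB _ _) _.
have h1 := height_le_enorm w (z' - y) wS.
have h2 := enorm_le_norm (z' - y).
have h3 := height_le_enorm w (c - y) wS.
by lra.
Qed.

(** * Descending through many stages *)

Section Cells.
Variable v : nat -> R * R.
Hypothesis v_S1 : forall n, (1 <= n)%N -> S1 (v n).

(** The shifts telescope: [mesh j / 32] is at most [(mesh j - mesh j.+1) / 31], because 63/64 >=
    31/32. *)
Lemma clear_descend m z k : clear v (mesh m.+1 / 2) m z ->
  exists z', `|z - z'| <= (mesh m.+1 - mesh (m + k).+1) / 31 /\
    clear v (mesh (m + k).+1 / 2) (m + k) z'.
Proof.
move=> cz; elim: k => [|k [z' [zz' cz']]].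
  by exists z; rewrite addn0 !subrr mul0r normr0.
have [//|s [s_le cs]] := @clear_step v (m + k) (height (v (m + k).+1) z').
  exact: v_S1.
set w := v _ in cs; have w1 : `|perp w| <= 1 by rewrite norm_perp norm_S1_le1 //; exact: v_S1.
have d0 := mesh_gt0 (m + k).+1; have dS := mesh_step (m + k).+1.
exists (z' + s *: perp w); rewrite addnS; split; last first.
  apply: cs => //; apply: clear_shift cz'; rewrite subrr normr0; lra.
rewrite opprD addrA; apply: le_trans (ler_normB _ _) _.
by have := norm_scale_le s w1; lra.
Qed.

Lemma clear_step_segment m w z T : v m.+1 = w ->
  (forall t, `|t| <= T -> clear v (mesh m.+1 / 16) m (z + t *: w)) ->
  exists s, `|s| <= mesh m.+1 / 32 /\ forall t, `|t| <= T ->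
    clear v (mesh m.+2 / 2) m.+1 (z + s *: perp w + t *: w).
Proof.
move=> <- cz; have wS := v_S1 m.+1 isT.
have [s [s_le cs]] := clear_step v m (height (v m.+1) z) wS.
exists s; split=> // t tT; rewrite addrAC; apply: cs; last exact: cz.
by rewrite -[z in LHS]addr0 -(scale0r (perp (v m.+1))) height_shift ?addr0.
Qed.

(** The segment only moves across itself, so its half-length [mesh n.+1 / 4] survives every stage of
    the run while the clear balls around its points shrink. Initially 1/4 + 1/16 <= 1/2 keeps those
    balls inside the cell. *)
Lemma clear_run w n z k : S1 w ->
  (forall i, (1 <= i)%N -> (i <= k.+1)%N -> v (n + i)%N = w) ->
  clear v (mesh n.+1 / 2) n z ->
  exists s, `|s| <= (mesh n.+1 - mesh (n + k.+1).+1) / 31 /\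
    forall t, `|t| <= mesh n.+1 / 4 ->
      clear v (mesh (n + k.+1).+1 / 2) (n + k.+1) (z + s *: perp w + t *: w).
Proof.
move=> wS vw cz; elim: k vw => [|k IH] vw.
  have d0 := mesh_gt0 n.+1; have dS := mesh_step n.+1.
  have [||s [s_le cs]] := @clear_step_segment n w z (mesh n.+1 / 4).
  - by rewrite -addn1 vw.
  - move=> t tT; apply: clear_shift cz.
    rewrite opprD addNKr normrN.
    by have := norm_scale_le t (norm_S1_le1 wS); lra.
  by exists s; rewrite addn1; split=> //; lra.
have [|s [s_le cs]] := IH.
  by move=> i i1 ik; apply: vw => //; exact: leqW.
have d0 := mesh_gt0 (n + k.+1).+1; have dS := mesh_step (n + k.+1).+1.
have [||s' [s'_le cs']] := @clear_step_segment (n + k.+1) w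
  (z + s *: perp w) (mesh n.+1 / 4).
- by rewrite -addnS vw.
- move=> t tT; apply: (clear_shift _ _ _ _ _ _ _ (cs t tT)).
  by rewrite subrr normr0; lra.
exists (s + s'); rewrite addnS; split; last by rewrite scalerDl addrA.
by apply: le_trans (ler_normD _ _) _; lra.
Qed.

(** One integer q controls both porosity constants, so that directions in D give countably many
    pieces. The holes miss all of [Q], not just the piece. *)
Definition porous_piece (Q : set (R * R)) w q : set (R * R) :=
  [set x | Q x /\ forall r, 0 < r -> r < q.+1%:R^-1 ->
     exists t, `|t| < r /\ eball (x + t *: w) (r / q.+1%:R) `&` Q = set0].

Lemma clear_avoid (Q : set (R * R)) w q m z : S1 w ->
  (forall N : nat, (1 <= N)%N -> exists n : nat, (N <= n)%N /\
     forall i : nat, (1 <= i)%N -> (i <= N)%N -> v (n + i)%N = w) ->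
  clear v (mesh m.+1 / 2) m z ->
  exists m' z', [/\ (m < m')%N, clear v (mesh m'.+1 / 2) m' z',
    `|z - z'| + mesh m'.+1 / 16 <= mesh m.+1 / 16 &
    forall x, `|z' - x| <= mesh m'.+1 / 16 -> ~ porous_piece Q w q x].
Proof.
move=> wS runs cz.
(* The run will start at n > k and have k+1 stages: n > m places it below the given cell, n > q
   makes [mesh n.+1 / 4] an admissible radius, and its length makes the final cells small compared
   with the holes. *)
pose k := (m + q.+1)%N; have qk : (q < k)%N by exact: leq_addl.
have [n [kn vw]] := runs k.+1 isT.
have mn : (m < n)%N by rewrite (leq_trans _ kn) // ltnS leq_addr.
have [z1 [zz1]] := clear_descend m z (n - m) cz.
rewrite subnKC ?(ltnW mn) // in zz1 * => cz1.
have [s [s_le cs]] := clear_run w n z1 k wS vw cz1.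
set m' := (n + k.+1)%N in s_le cs.
pose c t := z1 + s *: perp w + t *: w.
have w1 := norm_S1_le1 wS.
have pw1 : `|perp w| <= 1 by rewrite norm_perp.
have d0 := mesh_gt0 m'.+1.
have dn : 64 * mesh n.+1 <= mesh m.+1.
  rewrite -mesh_step (_ : n = (m.+1 + (n - m.+1))%N) ?mesh_add //.
  by rewrite subnKC.
have dm' : 64 * mesh m'.+1 <= mesh n.+1.
  by rewrite -mesh_step /m' addnS -addSn mesh_add.
have sub t : `|t| <= mesh n.+1 / 4 ->
    `|z - c t| + mesh m'.+1 / 16 <= mesh m.+1 / 16.
  move=> tT.
  rewrite (_ : z - c t = (z - z1) - s *: perp w - t *: w); last first.
    by rewrite /c !opprD !addrA.
  have h1 := ler_normB (z - z1 - s *: perp w) (t *: w).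
  have h2 := ler_normB (z - z1) (s *: perp w).
  have h3 := norm_scale_le s pw1; have h4 := norm_scale_le t w1.
  by lra.
apply: contrapT => noavoid.
have meets t : `|t| <= mesh n.+1 / 4 ->
    exists x, `|c t - x| <= mesh m'.+1 / 16 /\ porous_piece Q w q x.
  move=> tT; apply: contrapT => nox; apply: noavoid.
  exists m', (c t); split; [|exact: cs|exact: sub|].
    by rewrite (ltn_trans mn) // /m' addnS ltnS leq_addr.
  by move=> x cx Ax; apply: nox; exists x.
have [|a [ca [_ holes]]] := meets 0; first by rewrite normr0; lra.
have q0 : 0 < q.+1%:R :> R by rewrite ltr0n.
(* The radius is the half-length of the segment, so [c t] stays on it and [meets t] applies. *)
have [||t [tr hole]] := holes (mesh n.+1 / 4).
- by lra.
- rewrite -[ltRHS]mul1r ltr_pdivlMr //.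
  have qn : (q <= n.+1)%N by rewrite (leq_trans (ltnW qk)) // ltnW // ltnW.
  have := mesh_mul_add q 0 n.+1 qn.
  rewrite add0n {2}/mesh muln0 expr0 divr1 => le1.
  by lra.
(* The hole centre differs from [c t] by [a - c 0], so b is within [mesh m'.+1 / 8] of it in sup
   norm, hence inside the hole. *)
have [|b [cb [Qb _]]] := meets t; first exact: ltW.
suff : (eball (a + t *: w) (mesh n.+1 / 4 / q.+1%:R) `&` Q) b by rewrite hole.
split=> //; rewrite /eball /=; apply: le_lt_trans (enorm_le_norm _) _.
rewrite ltr_pdivlMr //.
have := mesh_mul_add q.+1 n.+1 k.+1.
rewrite addSn -/m' -[q.+2%:R]natr1 => /(_ _) le1.
have {}le1 : (q.+1%:R + 1) * mesh m'.+1 <= mesh n.+1 by apply: le1; exact: leqW.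
have : `|a + t *: w - b| <= mesh m'.+1 / 8.
  rewrite (_ : _ - b = - (c 0 - a) + (c t - b)); last first.
    by rewrite /c scale0r addr0 opprB addrA addrA subrK.
  by apply: le_trans (ler_normD _ _) _; rewrite normrN; lra.
have := normr_ge0 (a + t *: w - b); nra.
Qed.

End Cells.

(** * The common point of nested cells *)

Lemma nested_intervals (a e : nat -> R) :
  (forall i j : nat, (i <= j)%N -> `|a i - a j| <= e i) ->
  exists c, forall i, `|a i - c| <= e i.
Proof.
move=> ae; pose E := [set a i - e i | i in [set: nat]].
have ub (j : nat) : ubound E (a j + e j).
  move=> _ [i _ <-]; have [ij|ji] := leqP i j.
    have := ae i j ij; have := ae j j (leqnn j).
    by rewrite subrr normr0 ler_norml => h /andP[h1 h2]; lra.
  have := ae j i (ltnW ji); have := ae i i (leqnn i).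
  by rewrite subrr normr0 ler_norml => h /andP[h1 h2]; lra.
exists (sup E) => i; rewrite ler_norml; apply/andP; split.
- have : sup E <= a i + e i by apply: ge_sup => //; exists (a 0%N - e 0%N), 0%N.
  by lra.
- have : a i - e i <= sup E.
    by apply: ub_le_sup; [exists (a 0%N + e 0%N)|exists i].
  by lra.
Qed.

(** Sup-norm balls are products of intervals, so the point is found one coordinate at a time. *)
Lemma nested_balls (z : nat -> R * R) (e : nat -> R) :
  (forall i, 0 <= e i) ->
  (forall i, `|z i - z i.+1| + e i.+1 <= e i) ->
  exists p, forall i, `|z i - p| <= e i.
Proof.
move=> e0 ze.
have far i j : (i <= j)%N -> `|z i - z j| <= e i.
  move=> /subnKC <-.
  suff : `|z i - z (i + (j - i))%N| + e (i + (j - i))%N <= e i.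
    by have := e0 (i + (j - i))%N; lra.
  elim: (j - i)%N => [|k IH]; first by rewrite addn0 subrr normr0 add0r.
  rewrite addnS -(subrKA (z (i + k)%N) (z i) (- z (i + k).+1)).
  have := ler_normD (z i - z (i + k)%N) (z (i + k)%N - z (i + k).+1).
  by have := ze (i + k)%N; lra.
have [p1 h1] := nested_intervals (fun i => (z i).1) e
  (fun i j ij => le_trans (prod_norm_fst (z i - z j)) (far i j ij)).
have [p2 h2] := nested_intervals (fun i => (z i).2) e
  (fun i j ij => le_trans (prod_norm_snd (z i - z j)) (far i j ij)).
by exists (p1, p2) => i; apply/prod_normP; split; [exact: h1|exact: h2].
Qed.

Lemma subset_Hset v n m : (n <= m)%N -> Hset v n `<=` Hset v m.
Proof.
by move=> /subnKC <-; elim: (m - n)%N => [|k IH] x; rewrite ?addn0 // addnS => /IH; left.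
Qed.

(** The levels grow strictly, so [m n >= n] and cell number n already misses H_n. *)
Lemma clear_limit v (m : nat -> nat) (z : nat -> R * R) p :
  (forall i, (m i < m i.+1)%N) ->
  (forall i, clear v (mesh (m i).+1 / 2) (m i) (z i)) ->
  (forall i, `|z i - p| <= mesh (m i).+1 / 16) -> Pset v p.
Proof.
move=> mS cz zp [n _ Hp].
have im i : (i <= m i)%N by elim: i => // i IH; exact: leq_ltn_trans IH (mS i).
apply: (cz n p); last exact: subset_Hset (im n) _ Hp.
by apply: le_lt_trans (zp n) _; have := mesh_gt0 (m n).+1; lra.
Qed.

(** Tilting the unit direction by less than rho/4 moves the hole centre by at most r * rho/4, and
    the new radius is at most rho * r/4; the factor 2 between the norms uses up the rest of rho *
    r. *)
Lemma lower_porous_piece v (Q : set (R * R)) x w :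
  (forall n, (1 <= n)%N -> S1 (v n)) -> S1 `<=` closure (Dset v) ->
  Q x -> lower_porous_at Q x w ->
  exists l q, porous_piece Q (v l.+1) q x.
Proof.
move=> v_S1 v_dense Qx [rho [r0 [rho0 r00 por]]].
(* For w = 0 the line is the point x, and the hole would contain x itself, a point of [Q]. *)
have [w0|w0] := eqVneq (enorm w) 0.
  have [||y [[t _ <-] _ hole]] := por (r0 / 2); [by lra|by lra|].
  suff : (eball (x + t *: w) (rho * (r0 / 2)) `&` Q) x by rewrite hole.
  split=> //; rewrite /eball /= addrAC subrr add0r enormZ w0 mulr0.
  by rewrite mulr_gt0 // divr_gt0.
pose w' := (enorm w)^-1 *: w.
have w'S : S1 w'.
  by rewrite /S1 /= enormZ ger0_norm ?invr_ge0 ?enorm_ge0 // mulVf.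
have [_ [[[|l] //= _ <-]]] := v_dense w' w'S _ (nbhsx_ballx w' (rho / 4) ltac:(lra)).
rewrite ball_prod_normE /ball_ /= => w'l.
pose q := Num.truncn (Num.max (4 / rho) r0^-1).
have : Num.max (4 / rho) r0^-1 < q.+1%:R by exact: truncnS_gt.
have q0 : 0 < q.+1%:R :> R by rewrite ltr0n.
rewrite gt_max => /andP[q_rho q_r0].
exists l, q; split=> // r rpos rq.
have [|y [[t _ <-] ]] := por r rpos.
  by apply: lt_trans rq _; rewrite invf_plt.
rewrite opprD addNKr -scaleN1r scalerA enormZ mulN1r normrN => tr hole.
exists (t * enorm w); split; first by rewrite normrM (ger0_norm (enorm_ge0 w)).
apply/seteqP; split=> // b [bb Qb].
suff : (eball (x + t *: w) (rho * r) `&` Q) b by rewrite hole.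
split=> //; rewrite /eball /=; apply: le_lt_trans (enorm_le_norm _) _.
have {}bb := le_lt_trans (norm_le_enorm _) bb.
have -> : x + t *: w - b = (x + (t * enorm w) *: v l.+1 - b) +
    (t * enorm w) *: (w' - v l.+1).
  rewrite scalerBr scalerA -mulrA mulfV // mulr1.
  by rewrite [x + _ - b in RHS]addrAC -[RHS]addrA [X in _ = _ + X]addrCA subrr addr0 addrAC.
apply: le_lt_trans (ler_wpM2l _ (ler_normD _ _)) _ => //.
have : r / q.+1%:R <= rho * r / 4.
  by rewrite ler_pdivrMr //; move: q_rho; rewrite ltr_pdivrMr //; nra.
have : `|(t * enorm w) *: (w' - v l.+1)| <= r * (rho / 4).
  rewrite prod_norm_scale normrM (ger0_norm (enorm_ge0 w)).
  by apply: ler_pM; rewrite ?mulr_ge0 ?enorm_ge0 // ltW.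
by move=> le1 le2; have := lt_le_trans bb le2; rewrite mulrDr; lra.
Qed.

End Porosity.

Theorem theorem5p5 (R : realType) (v : nat -> R * R)
  (v_S1 : forall n : nat, (1 <= n)%N -> S1 (v n))
  (v_dense : S1 `<=` closure (Dset v))
  (v_runs : forall w : R * R, Dset v w ->
     forall N : nat, (1 <= N)%N ->
     exists n : nat, (N <= n)%N /\
       forall i : nat, (1 <= i)%N -> (i <= N)%N -> v (n + i)%N = w) :
  ~ sigma_directionally_lower_porous (Pset v).
Proof.
move=> [Q [porQ PQ]].
pose A (ilq : nat * nat * nat) := porous_piece (Q ilq.1.1) (v ilq.1.2.+1) ilq.2.
pose cell := {mz : nat * (R * R) | clear v (mesh mz.1.+1 / 2) mz.1 mz.2}.
pose next (c d : nat * cell) := [/\ d.1 = c.1.+1,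
  ((sval c.2).1 < (sval d.2).1)%N,
  `|(sval c.2).2 - (sval d.2).2| + mesh (sval d.2).1.+1 / 16
    <= mesh (sval c.2).1.+1 / 16 &
  (* The counter [c.1] codes the triple (i, l, q) whose piece is avoided at this step. *)
  forall x, `|(sval d.2).2 - x| <= mesh (sval d.2).1.+1 / 16 ->
    forall ilq, unpickle c.1 = Some ilq -> ~ A ilq x].
have next_ex (c : nat * cell) : {d | next c d}.
  apply: cid; case: c => j [[m z] /= cz].
  (* If j codes no triple, the piece of the default triple is avoided instead, so the level still
     increases. *)
  pose ilq := odflt (0, 0, 0)%N (unpickle j : option (nat * nat * nat)).
  have [||m' [z' [mm' cz' zz' avoid]]] := @clear_avoid R v v_S1 (Q ilq.1.1)
    (v ilq.1.2.+1) ilq.2 m z _ _ cz.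
  - exact: v_S1.
  - by apply: v_runs; exists ilq.1.2.+1.
  exists (j.+1, exist _ (m', z') cz'); split=> //= x /avoid nA ilq' eq_j.
  by move: nA; rewrite /A /ilq eq_j.
(* H_0 is empty, so any point starts the sequence. *)
have c0 : clear v (mesh 1 / 2) 0 (0 : R * R) by move=> y _ [].
have [f [f0 fS]] := dependent_choice next_ex (0%N, exist _ (0%N, 0) c0 : cell).
have fst_f i : (f i).1 = i.
  by elim: i => [|i IH]; [rewrite f0|case: (fS i) => -> _ _ _; rewrite IH].
have [p zp] := nested_balls (fun i => (sval (f i).2).2)
  (fun i => mesh (sval (f i).2).1.+1 / 16)
  (fun i => ltW (divr_gt0 (mesh_gt0 _) (ltr0n _ 16)))
  (fun i => let: And4 _ _ h _ := fS i in h).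
have Pp : Pset v p.
  apply: (@clear_limit R v (fun i => (sval (f i).2).1) _ p _ _ zp) => i.
    by case: (fS i).
  by case: (f i).2.
have [i _ Qp] : (\bigcup_i Q i) p by rewrite -PQ.
have [u por] := porQ i p Qp.
have [l [q Ap]] := lower_porous_piece v (Q i) p u v_S1 v_dense Qp por.
(* The step numbered by the code of (i, l, q) has put p outside this very piece. *)
case: (fS (pickle (i, l, q))) => _ _ _ /(_ p (zp _) (i, l, q)); apply=> //.
by rewrite fst_f pickleK.
Qed.
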